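(* The graph $T(18,3,32)$ is Leontovich at $n=7$. Specifically, $$\hom(E_7,T(18,3,32)) < \hom(P_7,T(18,3,32)).$$
   Context: All graphs are finite. For a simple loopless graph $G$ and a target graph $H$ (possibly with loops, no multi-edges), an $H$-coloring of $G$ is a map $f:V(G)\to V(H)$ such that $f(x)$ and $f(y)$ are adjacent in $H$ whenever $x$ and $y$ are adjacent in $G$; $\hom(G,H)$ denotes the number of $H$-colorings of $G$. $P_n$ is the path on $n$ vertices. $E_7$ is the tree on $7$ vertices obtained from $P_6$ (with vertices $v_1,\dots,v_6$ in path order) by adding one new vertex adjacent only to $v_4$, a vertex that is third from an end of the path. For positive integers $x,y,z$, $T(x,y,z)$ is the rooted tree in which the root has $x$ children, each child of the root has $y$ children, each grandchild of the root has $z$ children, and the great-grandchildren of the root have no children (so there are $1+x+xy+xyz$ vertices). It is regarded as an unrooted simple graph when used as a target. A graph $H$ is Leontovich at $n$ if there is a tree $T_n$ on $n$ vertices such that $\hom(T_n,H)<\hom(P_n,H)$. *)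

(* Defs.v *)
From mathcomp Require Import all_boot.

Set Implicit Arguments.
Unset Strict Implicit.
Unset Printing Implicit Defensive.

(* Finite undirected graphs without multi-edges; loops are allowed. *)
Record graph := Graph {
  vertex :> finType;
  adj : rel vertex;
  adj_sym : symmetric adj
}.

Definition simple (G : graph) : Prop := irreflexive (@adj G).

Definition is_coloring (G H : graph) (f : {ffun G -> H}) : bool :=
  [forall x, forall y, adj x y ==> adj (f x) (f y)].

Definition hom (G H : graph) : nat :=
  #|[set f : {ffun G -> H} | is_coloring f]|.

Definition connected (G : graph) : Prop :=
  0 < #|G| /\ forall x y : G, connect (@adj G) x y.

(* ucycle also accepts sequences of length at most 2, which are not cycles
   of a simple graph. *)
Definition acyclic (G : graph) : Prop :=
  forall c : seq G, 2 < size c -> ~ ucycle (@adj G) c.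

Definition is_tree (G : graph) : Prop :=
  [/\ simple G, connected G & acyclic G].

Definition path_adj (n : nat) : rel 'I_n :=
  fun i j => (i.+1 == j) || (j.+1 == i).

Lemma path_adj_sym (n : nat) : symmetric (@path_adj n).
Proof. by move=> i j; rewrite /path_adj orbC. Qed.

Definition path_graph (n : nat) : graph := Graph (@path_adj_sym n).

(* The path vertex v_k is [Some] of the ordinal k - 1, so v_4 has index 3;
   [None] is the added leaf. *)
Definition E7_adj : rel (option 'I_6) :=
  fun u v =>
    match u, v with
    | Some i, Some j => path_adj i j
    | Some i, None | None, Some i => i == 3 :> nat
    | None, None => false
    end.

Lemma E7_adj_sym : symmetric E7_adj.
Proof. by move=> [i|] [j|] //=; rewrite path_adj_sym. Qed.

Definition E7 : graph := Graph E7_adj_sym.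

(* The summands are, in order, the root, its children, its grandchildren and
   its great-grandchildren, each labelled by the branch leading to it. *)
Definition T_vertex (x y z : nat) : finType :=
  (unit + 'I_x + 'I_x * 'I_y + 'I_x * 'I_y * 'I_z)%type.

Definition T_parent (x y z : nat) (v : T_vertex x y z) :
    option (T_vertex x y z) :=
  match v with
  | inl (inl (inl _)) => None
  | inl (inl (inr _)) => Some (inl (inl (inl tt)))
  | inl (inr (a, _)) => Some (inl (inl (inr a)))
  | inr (ab, _) => Some (inl (inr ab))
  end.

Definition T_adj (x y z : nat) : rel (T_vertex x y z) :=
  fun u v => (T_parent u == Some v) || (T_parent v == Some u).

Lemma T_adj_sym (x y z : nat) : symmetric (@T_adj x y z).
Proof. by move=> u v; rewrite /T_adj orbC. Qed.

Definition T_graph (x y z : nat) : graph := Graph (@T_adj_sym x y z).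

Definition leontovich (H : graph) (n : nat) : Prop :=
  exists T : graph,
    [/\ is_tree T, #|T| = n & hom T H < hom (path_graph n) H].

(* Main.v *)
(* A coloring of P_7 is a walk on 7 vertices of the target; a coloring of E_7 is
   a walk on 6 vertices weighted by the degree of its fourth vertex.  Both are
   counted by iterating the adjacency operator of the target, which on T(x,y,z)
   preserves the functions that are constant on each level, so the counts reduce
   to arithmetic on 4-tuples: hom(E_7) = 81548856 < 81558090 = hom(P_7). *)
Require Import Defs.
From mathcomp Require Import all_boot.
From mathcomp Require Import zify.

Set Implicit Arguments.
Unset Strict Implicit.
Unset Printing Implicit Defensive.

(** * Acyclicity by ranking, and [E7] as a tree *)

Lemma acyclic_rank (G : graph) (rank : G -> nat) :
    (forall x y : G, adj x y -> rank x != rank y) ->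
    (forall x y z : G, adj x y -> adj x z ->
       rank y < rank x -> rank z < rank x -> y = z) ->
  acyclic G.
Proof.
move=> rank_neq lower_uniq c c_gt2 /andP[c_cycle c_uniq].
(* A cycle vertex of maximal rank has two distinct neighbours of lower rank. *)
have [x xc x_max]: exists2 x, x \in c & forall y, y \in c -> rank y <= rank x.
  have [x0 x0c]: exists x0, x0 \in c.
    by case: c c_gt2 {c_cycle c_uniq} => // x c _; exists x; rewrite mem_head.
  by case: (arg_maxnP rank x0c) => x xc x_max; exists x.
have lower y : adj x y -> y \in c -> rank y < rank x.
  by move=> xy yc; rewrite ltn_neqAle x_max // eq_sym rank_neq.
have [i p c_rot] := rot_to xc.
have mem_p y : y \in p -> y \in c.
  by move=> yp; rewrite -(mem_rot i) c_rot inE yp orbT.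
have sz_p : 1 < size p by move: c_gt2; rewrite -(size_rot i) c_rot.
move: c_cycle c_uniq; rewrite -(rot_cycle i) -(rot_uniq i) c_rot.
(* With two further vertices on the cycle, the successor [y] of [x] and its predecessor [last y' p]
   are different entries. *)
case: p sz_p mem_p {c_rot} => [|y [|y' p]] // _ mem_p.
rewrite (cycle_path x) /= => /and3P[zx xy _] /and3P[_ yp _].
have yc : y \in c by apply: mem_p; rewrite mem_head.
have zc : last y' p \in c by apply: mem_p; rewrite inE mem_last orbT.
rewrite adj_sym in zx.
suff yz : y = last y' p by rewrite yz mem_last in yp.
exact: lower_uniq xy zx (lower _ xy yc) (lower _ zx zc).
Qed.

Lemma E7_tree : is_tree E7.
Proof.
split.
- by move=> [i|] //=; rewrite /path_adj; lia.
- have E7_connect_root (x : E7) : connect (@adj E7) (Some ord0) x.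
    have path_root k (lt_k6 : k < 6) :
        connect (@adj E7) (Some ord0) (Some (Ordinal lt_k6)).
      elim: k lt_k6 => [|k IHk] lt_k6.
        by rewrite (_ : Ordinal lt_k6 = ord0) //; apply: val_inj.
      apply: connect_trans (IHk (ltnW lt_k6)) (connect1 _).
      by rewrite /= /path_adj eqxx.
    case: x => [[k lt_k6]|]; first exact: path_root.
    exact: connect_trans (path_root 3 isT) (connect1 _).
  split=> [|x y]; first by rewrite card_option card_ord.
  apply: connect_trans (E7_connect_root y).
  by rewrite (sym_connect_sym (@adj_sym E7)).
(* The added leaf gets rank 6, above all path indices: its only lower neighbour is index 3, and a
   path vertex has at most its predecessor below it. *)
- apply: (@acyclic_rank E7 (oapp (@nat_of_ord 6) 6)).
    by move=> [[i lti]|] [[j ltj]|] //=; rewrite /path_adj /=; lia.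
  move=> [[i lti]|] [[j ltj]|] [[k ltk]|] //=; rewrite /path_adj /=; try lia;
    move=> ij ik lt_ji lt_ki; congr Some; apply: val_inj => /=; lia.
Qed.

(** * Colorings of paths and of [E7] as weighted walks *)

Section WeightedWalks.

Variable H : graph.

Definition nbr_sum (F : H -> nat) (v : H) : nat := \sum_(u | adj v u) F u.

Lemma eq_nbr_sum (F F' : H -> nat) : F =1 F' -> nbr_sum F =1 nbr_sum F'.
Proof. by move=> eqF v; apply: eq_bigr => u _. Qed.

(* The total weight of the walks on [n.+1] vertices ending at [v], where a visit
   to [u] at time [i] contributes the factor [w i u]. *)
Fixpoint walk_weight (w : nat -> H -> nat) (n : nat) (v : H) : nat :=
  if n is m.+1 then nbr_sum (walk_weight w m) v * w n v else w 0 v.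

Definition ffcons n (v : H) (f : {ffun 'I_n -> H}) : {ffun 'I_n.+1 -> H} :=
  [ffun i => oapp f v (unlift ord0 i)].

Lemma ffcons0 n v (f : {ffun 'I_n -> H}) : ffcons v f ord0 = v.
Proof. by rewrite ffunE unlift_none. Qed.

Lemma ffconsS n v (f : {ffun 'I_n -> H}) i : ffcons v f (lift ord0 i) = f i.
Proof. by rewrite ffunE liftK. Qed.

Lemma ffcons_bij n :
  bijective (fun p : H * {ffun 'I_n -> H} => ffcons p.1 p.2).
Proof.
exists (fun f : {ffun 'I_n.+1 -> H} => (f ord0, [ffun i => f (lift ord0 i)])).
  move=> [v f] /=; rewrite ffcons0; congr pair.
  by apply/ffunP=> i; rewrite !ffunE liftK.
move=> f; apply/ffunP=> i; case: (unliftP ord0 i) => [j|] ->.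
  by rewrite ffconsS ffunE.
by rewrite ffcons0.
Qed.

(** Shifting indices by one carries the edges of the shorter path to all edges of the longer one
    except the first. *)
Lemma is_coloring_ffcons n v (f : {ffun 'I_n.+1 -> H}) :
  @is_coloring (path_graph n.+2) H (ffcons v f) =
  adj v (f ord0) && @is_coloring (path_graph n.+1) H f.
Proof.
apply/forallP/andP => [col|[vf /forallP col] x].
  split; last apply/forallP=> x; last apply/forallP=> y; last apply/implyP=> xy.
    have /forallP/(_ (lift ord0 ord0))/implyP := col ord0.
    by rewrite ffcons0 ffconsS; apply.
  have /forallP/(_ (lift ord0 y))/implyP := col (lift ord0 x).
  by rewrite !ffconsS; apply.
apply/forallP=> y; apply/implyP; rewrite /= /path_adj.
case: (unliftP ord0 x) => [i|] ->; case: (unliftP ord0 y) => [j|] ->;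
  rewrite ?ffcons0 ?ffconsS //= ?lift0 ?eqSS ?orbF => ij.
- by have /forallP/(_ j)/implyP := col i; apply.
- by rewrite adj_sym (_ : i = ord0) //; apply/val_inj/eqP; rewrite eq_sym.
- by rewrite (_ : j = ord0) //; apply/val_inj/eqP; rewrite eq_sym.
Qed.

(** Induction that strips the first vertex and moves its contribution into the weight of the next
    one; this changes the weights, so [w] stays general. *)
Lemma sum_path_coloring n (w : nat -> H -> nat) :
  \sum_(f : {ffun 'I_n.+1 -> H} | @is_coloring (path_graph n.+1) H f)
     \prod_(i < n.+1) w i (f i) = \sum_v walk_weight w n v.
Proof.
elim: n w => [|n IHn] w; rewrite (reindex _ (onW_bij _ (ffcons_bij _))) /=.
  rewrite -(pair_big_dep xpredT
    (fun v f => @is_coloring (path_graph 1) H (ffcons v f))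
    (fun v f => \prod_(i < 1) w i (ffcons v f i))) /=.
  apply: eq_bigr => v _.
  have f0 : {ffun 'I_0 -> H} by apply: finfun => -[].
  rewrite (big_pred1 f0) => [|f]; first by rewrite big_ord1 ffcons0.
  have -> : f = f0 by apply/ffunP=> -[].
  rewrite /= eqxx; apply/forallP=> x; apply/forallP=> y.
  by rewrite !ord1.
rewrite -(pair_big_dep xpredT
  (fun v f => @is_coloring (path_graph n.+2) H (ffcons v f))
  (fun v f => \prod_(i < n.+2) w i (ffcons v f i))) /=.
rewrite (exchange_big_dep (@is_coloring (path_graph n.+1) H)) /=; last first.
  by move=> v f _; rewrite is_coloring_ffcons => /andP[].
(* Absorb the first vertex of the path into the weight of the second one. *)
pose w' i u := if i is 0 then nbr_sum (w 0) u * w 1 u else w i.+1 u.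
(* [walk_weight] recurses at the last vertex, so merging the first two vertices only shifts its
   index. *)
have walk_weightS k : walk_weight w' k =1 walk_weight w k.+1.
  by elim: k => //= k IHk v; rewrite (eq_nbr_sum IHk).
rewrite -(eq_bigr _ (fun v _ => walk_weightS n v)) -IHn.
apply: eq_bigr => f col_f.
rewrite [RHS]big_ord_recl /= -mulnA big_distrl /=; apply: eq_big => v.
  by rewrite is_coloring_ffcons col_f andbT adj_sym.
move=> _; rewrite !big_ord_recl ffcons0 ffconsS; congr (_ * (_ * _)).
by apply: eq_bigr => i _; rewrite ffconsS.
Qed.

Lemma hom_path_graph n :
  hom (path_graph n.+1) H = \sum_v walk_weight (fun _ _ => 1) n v.
Proof.
rewrite -sum_path_coloring /hom -sum1_card; apply: eq_big => f.
  by rewrite inE.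
by move=> _; rewrite big1.
Qed.

(** Once the path is colored, the leaf can take as many colors as the degree of the color at index
    3. *)
Definition E7_weight (i : nat) (v : H) : nat :=
  if i == 3 then nbr_sum (fun _ => 1) v else 1.

Definition E7_extend (p : {ffun 'I_6 -> H} * H) : {ffun E7 -> H} :=
  [ffun x : option 'I_6 => oapp p.1 p.2 x].

Lemma E7_extend_bij : bijective E7_extend.
Proof.
exists (fun f : {ffun E7 -> H} => ([ffun i => f (Some i)], f None)).
  by move=> [f v]; congr pair; [apply/ffunP=> i|]; rewrite !ffunE.
by move=> f; apply/ffunP=> -[i|]; rewrite !ffunE //= ffunE.
Qed.

Lemma is_coloring_E7_extend (f : {ffun 'I_6 -> H}) (v : H) :
  is_coloring (E7_extend (f, v)) =
  @is_coloring (path_graph 6) H f && adj (f (inord 3)) v.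
Proof.
have eq3 (i : 'I_6) : i == 3 :> nat -> i = inord 3.
  by move/eqP=> i3; apply: val_inj; rewrite /= inordK.
apply/forallP/andP => [col|[/forallP col fv] [i|]].
- split.
    apply/forallP=> i; apply/forallP=> j.
    by have /forallP/(_ (Some j)) := col (Some i); rewrite !ffunE.
  have /forallP/(_ None)/implyP := col (Some (inord 3)).
  by rewrite !ffunE; apply; rewrite /= inordK.
- apply/forallP=> -[j|]; rewrite !ffunE /=.
    by have /forallP := col i; apply.
  by apply/implyP=> /eq3 ->.
- apply/forallP=> -[j|]; rewrite !ffunE //=.
  by apply/implyP=> /eq3 ->; rewrite adj_sym.
Qed.

Lemma hom_E7 : hom E7 H = \sum_v walk_weight E7_weight 5 v.
Proof.
rewrite -sum_path_coloring /hom -sum1_card.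
rewrite (reindex _ (onW_bij _ E7_extend_bij)) /=.
rewrite (eq_bigl (fun p => @is_coloring (path_graph 6) H p.1 &&
    adj (p.1 (inord 3)) p.2)) => [|[f v]]; last first.
  by rewrite inE is_coloring_E7_extend.
rewrite -(pair_big_dep (@is_coloring (path_graph 6) H)
  (fun f v => adj (f (inord 3)) v) (fun _ _ => 1)) /=.
(* Only the factor at index 3 differs from 1, and it counts the admissible colors of the leaf. *)
apply: eq_bigr => f _; rewrite (bigD1 (inord 3)) //= [X in _ * X]big1 => [|i].
  by rewrite /E7_weight inordK // muln1.
move=> i_neq3; rewrite /E7_weight; case: eqP => // i3.
by case/eqP: i_neq3; apply: val_inj; rewrite /= inordK.
Qed.

End WeightedWalks.

(** * The adjacency operator on level-constant functions of [T_graph] *)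

Section Levels.

Variables x y z : nat.

Definition level_fun (l : nat * nat * nat * nat) (v : T_graph x y z) : nat :=
  let: (a, b, c, d) := l in
  match v with
  | inl (inl (inl _)) => a
  | inl (inl (inr _)) => b
  | inl (inr _) => c
  | inr _ => d
  end.

Lemma sum_T_vertex (P : pred (T_graph x y z)) (F : T_graph x y z -> nat) :
  \sum_(v | P v) F v =
  (if P (inl (inl (inl tt))) then F (inl (inl (inl tt))) else 0) +
  \sum_(i | P (inl (inl (inr i)))) F (inl (inl (inr i))) +
  \sum_(p | P (inl (inr p))) F (inl (inr p)) +
  \sum_(q | P (inr q)) F (inr q).
Proof.
rewrite !big_sumType /=; congr (_ + _ + _ + _).
by rewrite big_mkcond /= (big_pred1 tt) // => -[].
Qed.

Lemma sum_level_fun a b c d :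
  \sum_v level_fun (a, b, c, d) v = a + x * b + x * y * c + x * y * z * d.
Proof. by rewrite sum_T_vertex /= !sum_nat_const !card_prod !card_ord. Qed.

(** A vertex has at most one parent, and [x], [y], [z] or no children according to its level, so the
    operator acts as a 4 by 4 matrix. *)
Lemma nbr_sum_level_fun a b c d :
  nbr_sum (level_fun (a, b, c, d)) =1
  level_fun (x * b, a + y * c, b + z * d, c).
Proof.
(* The children of a vertex labelled [i] are the pairs with first component [i]. *)
have sum_fst m (I : finType) (i : I) e :
    \sum_(p : I * 'I_m | p.1 == i) e = m * e.
  rewrite (eq_bigl (fun p => (p.1 == i) && true)) => [|p]; last by rewrite andbT.
  rewrite -(pair_big (pred1 i) xpredT (fun _ _ => e)) big_pred1_eq.
  by rewrite sum_nat_const card_ord.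
move=> v; rewrite /nbr_sum sum_T_vertex /= /T_adj.
case: v => [[[[]|i]|p]|[p k]] /=.
- rewrite sum_nat_const card_ord [X in _ + X + _]big_pred0 => [|[]] //.
  by rewrite big_pred0 ?addn0 // => -[].
- rewrite big_pred0 // (eq_bigl (fun p => p.1 == i)) => [|[]] //.
  by rewrite sum_fst big_pred0 ?addn0 // => -[].
- case: p => i j /=; rewrite (big_pred1 i) => [|i']; last first.
    by rewrite orbF [RHS]eq_sym.
  rewrite big_pred0 => [|[]] //.
  by rewrite (eq_bigl (fun q => q.1 == (i, j))) ?sum_fst ?addn0 // => -[].
- case: p => i j /=; rewrite big_pred0 // (big_pred1 (i, j)) => [|[i' j']].
    by rewrite big_pred0 ?addn0 // => -[].
  by rewrite orbF [RHS]eq_sym.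
Qed.

Fixpoint level_walk (l : nat -> nat * nat * nat * nat) (n : nat) :=
  if n is m.+1 then
    let: (a, b, c, d) := level_walk l m in
    let: (a', b', c', d') := l n in
    (x * b * a', (a + y * c) * b', (b + z * d) * c', c * d')
  else l 0.

Lemma walk_weight_level_fun w l n :
    (forall i, w i =1 level_fun (l i)) ->
  walk_weight w n =1 level_fun (level_walk l n).
Proof.
move=> w_l; elim: n => [|n IHn] v /=; first exact: w_l.
rewrite (eq_nbr_sum IHn) w_l.
case: (level_walk l n) => [[[a b] c] d]; rewrite nbr_sum_level_fun.
by case: (l n.+1) => [[[a' b'] c'] d']; case: v => [[[]|]|].
Qed.

Lemma level_fun1 : (fun _ => 1) =1 level_fun (1, 1, 1, 1).
Proof. by case=> [[[]|]|]. Qed.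

End Levels.

Theorem theorem1p3 :
  leontovich (T_graph 18 3 32) 7 /\
  hom E7 (T_graph 18 3 32) < hom (path_graph 7) (T_graph 18 3 32).
Proof.
suff lt_hom : hom E7 (T_graph 18 3 32) < hom (path_graph 7) (T_graph 18 3 32).
  split=> //; exists E7; split=> //; first exact: E7_tree.
  by rewrite card_option card_ord.
set H := T_graph 18 3 32.
(* The degrees 18, 4, 33, 1 by level, left in the form that [nbr_sum_level_fun] yields on the
   constant 1. *)
pose degs := (18 * 1, 1 + 3 * 1, 1 + 32 * 1, 1).
have weight_degs i : @E7_weight H i =1
    level_fun (if i == 3 then degs else (1, 1, 1, 1)).
  rewrite /E7_weight => v; case: eqP => _; last exact: level_fun1.
  by rewrite (eq_nbr_sum (level_fun1 (z := 32))) nbr_sum_level_fun.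
rewrite hom_E7 hom_path_graph.
(* The index counts edges of the walk: 5 for the path inside [E7], 6 for the path on 7 vertices. *)
rewrite (eq_bigr _ (fun v _ => walk_weight_level_fun 5 weight_degs v)).
rewrite (eq_bigr _ (fun v _ =>
  walk_weight_level_fun 6 (fun _ => level_fun1 (z := 32)) v)).
rewrite /level_walk /= !sum_level_fun.
lia.
Qed.
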